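(* For all integers $n, m \geq 2$, there exist equilateral sets of cardinality $m$ in $\mathcal{BM}_s^n$.
   Context: The Banach--Mazur distance between two real normed spaces $X, Y$ of the same finite dimension is $d_{BM}(X,Y) = \inf \|T\|\,\|T^{-1}\|$, the infimum over all invertible linear operators $T: X \to Y$, with operator norms. The symmetric Banach--Mazur compactum $\mathcal{BM}^n_s$ is the set of (linear) isometry classes of $n$-dimensional real normed spaces (equivalently, of affine equivalence classes of $0$-symmetric convex bodies in $\mathbb{R}^n$), equipped with the multiplicative metric $d_{BM}$. A set $S$ in this space is equilateral if there exists $d > 0$ such that $d_{BM}(X,Y) = d$ for all distinct $X, Y \in S$. *)

(* Defs.v *)
From HB Require Import structures.
From mathcomp Require Import all_boot all_order all_algebra.
From mathcomp Require Import all_classical all_reals.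

Set Implicit Arguments.
Unset Strict Implicit.
Unset Printing Implicit Defensive.

Import Order.TTheory GRing.Theory Num.Theory.

Local Open Scope classical_set_scope.
Local Open Scope ring_scope.
Local Open Scope quotient_scope.

(* Every n-dimensional real normed space is isometric to R^n with some norm,
   so the norms on 'rV[R]_n are used as the n-dimensional normed spaces.
   Nonnegativity of a norm follows from the three axioms. *)
Record norm (R : realType) (n : nat) := Norm {
  norm_fun :> 'rV[R]_n -> R;
  normD : forall x y, norm_fun (x + y) <= norm_fun x + norm_fun y;
  normZ : forall a x, norm_fun (a *: x) = `|a| * norm_fun x;
  norm_eq0 : forall x, norm_fun x = 0 -> x = 0 }.

HB.instance Definition _ (R : realType) (n : nat) := gen_eqMixin (norm R n).
HB.instance Definition _ (R : realType) (n : nat) := gen_choiceMixin (norm R n).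

(* The linear operators are the maps x |-> x *m T on row vectors; they are
   invertible exactly when T \in unitmx, with inverse given by invmx T.
   In finite dimension the set below is bounded, so sup takes no default value. *)
Definition opnorm (R : realType) (n : nat) (p q : norm R n) (T : 'M[R]_n) : R :=
  sup [set q (x *m T) | x in [set x | p x <= 1]].

Definition norm_dBM (R : realType) (n : nat) (p q : norm R n) : R :=
  inf [set opnorm p q T * opnorm q p (invmx T)
      | T in [set T : 'M[R]_n | T \in unitmx]].

Definition isometric (R : realType) (n : nat) (p q : norm R n) : Prop :=
  exists2 T : 'M[R]_n, T \in unitmx & forall x, q (x *m T) = p x.

Section Compactum.
Variables (R : realType) (n : nat).
Implicit Types (p q r : norm R n).

Lemma isometric_refl p : isometric p p.
Proof. by exists 1%:M; rewrite ?unitmx1// => x; rewrite mulmx1. Qed.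

Lemma isometric_sym p q : isometric p q -> isometric q p.
Proof.
move=> [T uT pq]; exists (invmx T); first by rewrite unitmx_inv.
by move=> x; rewrite -pq mulmxKV.
Qed.

Lemma isometric_trans q p r : isometric p q -> isometric q r -> isometric p r.
Proof.
move=> [T uT pq] [U uU qr]; exists (T *m U); first by rewrite unitmx_mul uT.
by move=> x; rewrite mulmxA qr pq.
Qed.

Definition isometricb : rel (norm R n) := fun p q => `[< isometric p q >].

Lemma isometricb_refl : reflexive isometricb.
Proof. by move=> p; apply/asboolP/isometric_refl. Qed.

Lemma isometricb_sym : symmetric isometricb.
Proof. by move=> p q; apply: asbool_equiv_eq; split; apply: isometric_sym. Qed.

Lemma isometricb_trans : transitive isometricb.
Proof.
by move=> q p r /asboolP pq /asboolP qr; apply/asboolP/(isometric_trans pq).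
Qed.

Canonical isometricb_equiv :=
  EquivRel isometricb isometricb_refl isometricb_sym isometricb_trans.

Definition BMs : Type := {eq_quot isometricb}.
HB.instance Definition _ := EqQuotient.on BMs.
HB.instance Definition _ := Choice.on BMs.

Lemma BMs_eqP p q : \pi_BMs p = \pi_BMs q <-> isometric p q.
Proof.
by split=> [/eqquotP/asboolP//|pq]; apply/eqquotP/asboolP.
Qed.

Definition dBM : BMs -> BMs -> R := lift_fun2 BMs (@norm_dBM R n).

Lemma opnorm_isometry p p' q q' (A B T : 'M[R]_n) : A \in unitmx ->
  (forall x, p' (x *m A) = p x) -> (forall x, q' (x *m B) = q x) ->
  opnorm p' q' (invmx A *m T *m B) = opnorm p q T.
Proof.
move=> uA pA qB; congr sup; apply/seteqP; split=> _ [x px <-].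
  exists (x *m invmx A); first by rewrite /= -pA mulmxKV.
  by rewrite -qB !mulmxA.
exists (x *m A); first by rewrite /= pA.
by rewrite !mulmxA mulmxK// qB.
Qed.

Lemma norm_dBM_isometric p p' q q' : isometric p p' -> isometric q q' ->
  norm_dBM p q = norm_dBM p' q'.
Proof.
move=> [A uA pA] [B uB qB].
have invE (T : 'M[R]_n) : T \in unitmx ->
    invmx (invmx A *m T *m B) = invmx B *m invmx T *m A.
  move=> uT; have u : invmx A *m T *m B \in unitmx.
    by rewrite !unitmx_mul unitmx_inv uA uT.
  apply: (can_inj (mulKmx u)); rewrite mulmxV//.
  by rewrite !mulmxA mulmxK// mulmxK// mulVmx.
congr inf; apply/seteqP; split=> _ [T /= uT <-].
  exists (invmx A *m T *m B); first by rewrite /= !unitmx_mul unitmx_inv uA uT.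
  by rewrite invE// (opnorm_isometry _ uA pA qB) (opnorm_isometry _ uB qB pA).
have E : T = invmx A *m (A *m T *m invmx B) *m B.
  by rewrite !mulmxA mulVmx// mul1mx mulmxKV.
have uT' : A *m T *m invmx B \in unitmx.
  by rewrite !unitmx_mul unitmx_inv uA uT.
exists (A *m T *m invmx B) => //.
by rewrite {3 4}E invE// (opnorm_isometry _ uA pA qB)
  (opnorm_isometry _ uB qB pA).
Qed.

Lemma pi_dBM p q : dBM (\pi_BMs p) (\pi_BMs q) = norm_dBM p q.
Proof.
rewrite /dBM; unlock; apply: norm_dBM_isometric; apply/BMs_eqP; exact: reprK.
Qed.

Definition equilateral (S : set BMs) : Prop :=
  exists2 d : R, 0 < d &
    forall X Y : BMs, S X -> S Y -> X <> Y -> dBM X Y = d.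

End Compactum.

(* Main.v *)
(** For a set [A] of unit vectors and [c > 1] close to 1, let
    [p_A x = max (|x|, c * max_(a in A) |<a, x>|)]. If [A] is contained in [B]
    then [p_A <= p_B <= c p_A], so the two norms are at distance at most [c].
    Take for [A], [B] unions of [N], [N'] orthonormal frames of one plane, with
    all lines distinct and [2 N < N']. If [p_B (x T) <= alpha p_A x] and
    [p_A (x S) <= beta p_B x] with [S = T^-1] and [alpha beta < c], then [S] is
    nearly a similarity, so each of the [2 N] lines of [A] is close to the
    [S]-image of at most one line of [B]; hence some frame [v, v'] of [B] has
    [p_A = |.|] at [v S] and [v' S]. Then
    [2 c^2 <= alpha^2 (|v S|^2 + |v' S|^2) = alpha^2 (|e1 S|^2 + |e2 S|^2)],
    while a frame [e1, e2] of the same plane avoiding all the caps gives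
    [|e_i S| <= beta p_B e_i = beta], so [c <= alpha beta]. *)
Require Import Defs.
From mathcomp Require Import all_boot all_order all_algebra.
From mathcomp Require Import all_classical all_reals.
From mathcomp Require Import ring lra.
Set Implicit Arguments.
Unset Strict Implicit.
Unset Printing Implicit Defensive.

Import Order.TTheory GRing.Theory Num.Theory.
Local Open Scope classical_set_scope.
Local Open Scope ring_scope.

(** * Euclidean geometry of row vectors and of nearly isometric matrices *)

Section Euclidean.
Variables (R : realType) (n : nat).
Implicit Types (x y z a : 'rV[R]_n).

Definition dot x y : R := \sum_i x 0 i * y 0 i.

Lemma dotC x y : dot x y = dot y x.
Proof. by apply: eq_bigr => i _; rewrite mulrC. Qed.

Lemma dotDl x y z : dot (x + y) z = dot x z + dot y z.
Proof. by rewrite -big_split; apply: eq_bigr => i _; rewrite mxE mulrDl. Qed.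

Lemma dotZl (k : R) x y : dot (k *: x) y = k * dot x y.
Proof. by rewrite mulr_sumr; apply: eq_bigr => i _; rewrite mxE mulrA. Qed.

Lemma dotDr x y z : dot x (y + z) = dot x y + dot x z.
Proof. by rewrite dotC dotDl !(dotC x). Qed.

Lemma dotZr (k : R) x y : dot x (k *: y) = k * dot x y.
Proof. by rewrite dotC dotZl dotC. Qed.

Lemma dot_ge0 x : 0 <= dot x x.
Proof. by apply: sumr_ge0 => i _; rewrite -expr2 sqr_ge0. Qed.

Lemma dot_eq0 x : dot x x = 0 -> x = 0.
Proof.
move=> x0; apply/rowP => i; rewrite mxE; apply/eqP; rewrite -sqrf_eq0 expr2.
by have /psumr_eq0P -> := x0 => // j _; rewrite -expr2 sqr_ge0.
Qed.

Lemma cauchy_schwarz x y : dot x y ^+ 2 <= dot x x * dot y y.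
Proof.
have [y0|yn0] := eqVneq (dot y y) 0.
  have -> : x = x + 0 *: x by rewrite scale0r addr0.
  by rewrite (dot_eq0 y0) -(scale0r x) !dotZr !mul0r mulr0 expr0n.
have yp : 0 < dot y y by rewrite lt0r yn0 dot_ge0.
have := dot_ge0 (dot y y *: x + (- dot x y) *: y).
rewrite !(dotDl, dotDr, dotZl, dotZr) (dotC y x) => h.
rewrite -subr_ge0 -(pmulr_rge0 _ yp).
by apply: le_trans h _; rewrite le_eqVlt; apply/orP; left; apply/eqP; ring.
Qed.

Definition enorm x : R := Num.sqrt (dot x x).

Lemma enorm_ge0 x : 0 <= enorm x.
Proof. exact: sqrtr_ge0. Qed.

Lemma sqr_enorm x : enorm x ^+ 2 = dot x x.
Proof. by rewrite sqr_sqrtr ?dot_ge0. Qed.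

Lemma enorm_eq0 x : enorm x = 0 -> x = 0.
Proof. by move=> x0; apply: dot_eq0; rewrite -sqr_enorm x0 expr0n. Qed.

Lemma enormZ (k : R) x : enorm (k *: x) = `|k| * enorm x.
Proof.
by rewrite /enorm dotZl dotZr mulrA -expr2 sqrtrM ?sqr_ge0// sqrtr_sqr.
Qed.

Lemma dot_le_enorm x y : `|dot x y| <= enorm x * enorm y.
Proof.
rewrite -(ler_pXn2r (ltn0Sn 1)) ?nnegrE ?mulr_ge0 ?enorm_ge0//.
by rewrite real_normK ?num_real// exprMn !sqr_enorm cauchy_schwarz.
Qed.

Lemma enormD x y : enorm (x + y) <= enorm x + enorm y.
Proof.
rewrite -(ler_pXn2r (ltn0Sn 1)) ?nnegrE ?addr_ge0 ?enorm_ge0//.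
rewrite sqr_enorm dotDl !dotDr (dotC y x) sqrrD !sqr_enorm.
have := le_trans (ler_norm _) (dot_le_enorm x y); lra.
Qed.

(** Cauchy-Schwarz applied to each column of [T]; the constant is the Frobenius norm of [T]. *)
Lemma enorm_mulmx_bounded (T : 'M[R]_n) :
  exists2 C : R, 0 <= C & forall x, enorm (x *m T) <= C * enorm x.
Proof.
exists (Num.sqrt (\sum_j dot (\row_i T i j) (\row_i T i j))) => [|x].
  exact: sqrtr_ge0.
rewrite /enorm -sqrtrM; last by apply: sumr_ge0 => j _; exact: dot_ge0.
apply: ler_wsqrtr; rewrite mulr_suml; apply: ler_sum => j _.
apply: le_trans (_ : dot x (\row_i T i j) ^+ 2 <= _); last first.
  by rewrite mulrC cauchy_schwarz.
rewrite -expr2 le_eqVlt; apply/orP; left; apply/eqP; congr (_ ^+ 2).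
by rewrite mxE; apply: eq_bigr => i _; rewrite mxE.
Qed.

(* Both [x] and [y] are nearly parallel to [a]: compare the components
   orthogonal to [a] by Cauchy-Schwarz. *)
Lemma dot_near_common_axis (c : R) a x y : 1 <= c -> dot a a = 1 ->
  dot x x <= (c * dot a x) ^+ 2 -> dot y y <= (c * dot a y) ^+ 2 ->
  (2 / c ^+ 2 - 1) * (enorm x * enorm y) <= `|dot x y|.
Proof.
move=> c1 a1 hx hy; have c0 : 0 < c by lra.
set k := (c ^+ 2)^-1.
have kc : k * c ^+ 2 = 1 by rewrite mulVf// expf_neq0// gt_eqF.
have k0 : 0 < k by rewrite invr_gt0 exprn_gt0.
have k1 : k <= 1 by rewrite invf_le1 ?exprn_gt0// exprn_ege1.
have hp := cauchy_schwarz a x; have hq := cauchy_schwarz a y.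
have := cauchy_schwarz (x + (- dot a x) *: a) (y + (- dot a y) *: a).
rewrite !(dotDl, dotDr, dotZl, dotZr) a1 !(dotC _ a).
have X0 := enorm_ge0 x; have Y0 := enorm_ge0 y.
rewrite a1 mul1r -(sqr_enorm x) in hx hp *.
rewrite a1 mul1r -(sqr_enorm y) in hy hq *.
set X := enorm x in hx hp X0 *; set Y := enorm y in hy hq Y0 *.
set p := dot a x in hx hp *; set q := dot a y in hy hq *.
have kx : k * X ^+ 2 <= p ^+ 2.
  by rewrite -(mul1r (p ^+ 2)) -kc -mulrA -exprMn ler_pM2l.
have ky : k * Y ^+ 2 <= q ^+ 2.
  by rewrite -(mul1r (q ^+ 2)) -kc -mulrA -exprMn ler_pM2l.
move: (dot x y) => D cs.
(* [D - p * q] is the inner product of the components orthogonal to [a], whose squared lengths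
   [X ^+ 2 - p ^+ 2] and [Y ^+ 2 - q ^+ 2] are at most the fraction [1 - k] of [X ^+ 2] and
   [Y ^+ 2]. *)
have cs' : (D - p * q) ^+ 2 <= ((1 - k) * (X * Y)) ^+ 2.
  apply: le_trans (_ : (X ^+ 2 - p ^+ 2) * (Y ^+ 2 - q ^+ 2) <= _); first by lra.
  have -> : ((1 - k) * (X * Y)) ^+ 2 = ((1 - k) * X ^+ 2) * ((1 - k) * Y ^+ 2).
    by ring.
  by apply: ler_pM; lra.
have XY0 : 0 <= X * Y by rewrite mulr_ge0.
have h1 : `|D - p * q| <= (1 - k) * (X * Y).
  rewrite -(ler_pXn2r (ltn0Sn 1)) ?nnegrE ?mulr_ge0 ?subr_ge0//.
  by rewrite real_normK ?num_real.
have h2 : k * (X * Y) <= `|p * q|.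
  rewrite -(ler_pXn2r (ltn0Sn 1)) ?nnegrE ?mulr_ge0 ?(ltW k0)//.
  rewrite real_normK ?num_real//.
  have -> : (k * (X * Y)) ^+ 2 = (k * X ^+ 2) * (k * Y ^+ 2) by ring.
  by rewrite exprMn ler_pM// mulr_ge0 ?sqr_ge0 ?(ltW k0).
have := ler_normB D (D - p * q); rewrite opprB addrC subrK; lra.
Qed.

(* The images of the separated vectors [v] and [w] under a nearly isometric [S]
   cannot both be nearly parallel to [a]. *)
Lemma caps_disjoint (S : 'M[R]_n) (alpha beta c d : R) (v w a : 'rV[R]_n) :
    (forall x, enorm x <= alpha * c * enorm (x *m S)) ->
    (forall x, enorm (x *m S) <= beta * c * enorm x) ->
    0 <= alpha -> 0 <= beta -> alpha * beta < c -> 1 <= c ->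
    0 < d <= 1 -> 8 * (c ^+ 2 - 1) <= d ->
    dot v v = 1 -> dot w w = 1 -> dot a a = 1 -> `|dot v w| <= 1 - d ->
    enorm (v *m S) < c * `|dot a (v *m S)| ->
    enorm (w *m S) < c * `|dot a (w *m S)| -> False.
Proof.
move=> lo up al0 be0 ab c1 /andP[d0 d1] cd v1 w1 a1 sep hx hy.
have c0 : 0 < c by lra.
have [s [s2 sD]] : exists s : R, s ^+ 2 = 1 /\
    s * dot (v *m S) (w *m S) = `|dot (v *m S) (w *m S)|.
  exists ((-1) ^+ (dot (v *m S) (w *m S) < 0)%R).
  by rewrite sqrr_sign -normrEsign.
(* The image of this vector is a difference of two vectors of equal length which, by the choice of
   the sign [s], are nearly equal; the image is therefore short, while the separation of [v] and [w]
   keeps the vector itself long. *)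
have := lo (enorm (w *m S) *: v + (- s * enorm (v *m S)) *: w).
rewrite mulmxDl -!scalemxAl => lz.
have vn : enorm v = 1 by rewrite /enorm v1 sqrtr1.
have wn : enorm w = 1 by rewrite /enorm w1 sqrtr1.
have upv := up v; have upw := up w; have lov := lo v; have low := lo w.
rewrite vn wn !mulr1 in upv upw lov low.
have sq z : enorm z < c * `|dot a z| -> dot z z <= (c * dot a z) ^+ 2.
  move=> h; rewrite -sqr_enorm -(real_normK (num_real (c * _))).
  by rewrite ler_pXn2r ?nnegrE ?enorm_ge0// normrM gtr0_norm// ltW.
have near := dot_near_common_axis c1 a1 (sq _ hx) (sq _ hy).
have X0 := enorm_ge0 (v *m S); have Y0 := enorm_ge0 (w *m S).
have acn0 : 0 <= alpha * c by rewrite mulr_ge0// ltW.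
have Xp : 0 < enorm (v *m S).
  rewrite lt0r X0 andbT; apply/eqP => X00; move: lov; rewrite X00 mulr0; lra.
have Yp : 0 < enorm (w *m S).
  rewrite lt0r Y0 andbT; apply/eqP => Y00; move: low; rewrite Y00 mulr0; lra.
have svw : s * dot v w <= 1 - d.
  apply: le_trans (ler_norm _) _; rewrite normrM.
  have /eqP := s2; rewrite sqrf_eq1 => /orP[] /eqP ->;
  by rewrite ?normrN normr1 mul1r.
move: lz; rewrite -(ler_pXn2r (ltn0Sn 1)) ?nnegrE ?mulr_ge0 ?enorm_ge0 ?(ltW c0)//.
rewrite exprMn !sqr_enorm.
rewrite !(dotDl, dotDr, dotZl, dotZr) (dotC w v) (dotC (w *m S) (v *m S)) v1 w1.
rewrite -!sqr_enorm; move: near; rewrite -sD.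
move: (dot v w) (dot (v *m S) (w *m S)) (enorm (v *m S)) (enorm (w *m S)) svw
  Xp Yp upw upv => p D X Y svw Xp Yp upw upv near.
have XY0 : 0 < X * Y by rewrite mulr_gt0.
have -> : Y * (Y * 1 + - s * X * p) +
      (Y * (- s * X * p) + - s * X * (- s * X * 1)) =
    Y ^+ 2 + s ^+ 2 * X ^+ 2 - 2 * (X * Y) * (s * p) by ring.
have -> : Y * (Y * X ^+ 2 + - s * X * D) +
      - s * X * (Y * D + - s * X * Y ^+ 2) =
    (X * Y) * ((1 + s ^+ 2) * (X * Y) - 2 * (s * D)) by ring.
rewrite s2 => lz.
(* On the left, [X ^+ 2 + Y ^+ 2 >= 2 * (X * Y)] and [s * p <= 1 - d]; on the right, [near] bounds
   [s * D] from below. *)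
have lhs : (X * Y) * (2 * d) <=
    (X * Y) * ((alpha * c) ^+ 2 * (4 * (X * Y) * (1 - (c ^+ 2)^-1))).
  have : (X * Y) * (s * p) <= (X * Y) * (1 - d) by rewrite ler_pM2l.
  have : (alpha * c) ^+ 2 * (X * Y * ((1 + 1) * (X * Y) - 2 * (s * D))) <=
     (alpha * c) ^+ 2 * (X * Y * (4 * (X * Y) * (1 - (c ^+ 2)^-1))).
    by rewrite ler_wpM2l ?sqr_ge0// ler_pM2l//; move: near; lra.
  have := sqr_ge0 (X - Y); lra.
rewrite ler_pM2l// in lhs.
have c2 : c ^+ 2 != 0 by rewrite expf_neq0 ?gt_eqF.
have rhs : (alpha * c) ^+ 2 * (4 * (X * Y) * (1 - (c ^+ 2)^-1)) =
   4 * (X * Y) * (alpha ^+ 2 * (c ^+ 2 - 1)).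
  rewrite exprMn; move: (c ^+ 2) c2 => q q0; field; exact: q0.
rewrite rhs in lhs.
have q1 : 0 <= c ^+ 2 - 1 by rewrite subr_ge0 exprn_ege1.
have XYb : X * Y <= (beta * c) ^+ 2 by rewrite expr2 ler_pM// ltW.
have ab2 : (alpha * beta) ^+ 2 <= c ^+ 2.
  by rewrite ler_pXn2r ?nnegrE ?mulr_ge0// ltW.
have : X * Y * (alpha ^+ 2 * (c ^+ 2 - 1)) <=
    (beta * c) ^+ 2 * (alpha ^+ 2 * (c ^+ 2 - 1)).
  by rewrite ler_wpM2r// mulr_ge0 ?sqr_ge0.
have : (alpha * beta) ^+ 2 * (c ^+ 2 * (c ^+ 2 - 1)) <=
    c ^+ 2 * (c ^+ 2 * (c ^+ 2 - 1)).
  by rewrite ler_wpM2r// mulr_ge0 ?sqr_ge0.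
rewrite !exprMn; move: lhs q1 cd; move: (c ^+ 2) => q lhs q1 cd.
(* Since [8 * (q - 1) <= d <= 1], [q] is at most 9/8. The estimates then chain to [2 * d <= 4 * (q *
   q * (q - 1)) <= 8 * (q - 1) <= d], against [0 < d]. *)
have q2 : q * q <= 2 by nra.
have : q * q * (q - 1) <= 2 * (q - 1) by rewrite ler_wpM2r.
lra.
Qed.

End Euclidean.

(** * Orthonormal frames of rational slope in the plane of [e1] and [e2] *)

Section Directions.
Variables (R : realType) (n : nat) (e1 e2 : 'rV[R]_n).
Hypotheses (e11 : dot e1 e1 = 1) (e22 : dot e2 e2 = 1) (e12 : dot e1 e2 = 0).

(** The unit vector of slope [k] in the plane, and for [b = true] its quarter turn. The frame
    [k = 0] is [e1], [e2] itself; integer slopes make the angles between frames computable without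
    trigonometry. *)
Definition direction (k : nat) (b : bool) : 'rV[R]_n :=
  (Num.sqrt (1 + k%:R ^+ 2))^-1 *:
    (if b then - k%:R *: e1 + e2 else e1 + k%:R *: e2).

Let scale2 (k : nat) :
  (Num.sqrt (1 + k%:R ^+ 2 : R))^-1 ^+ 2 * (1 + k%:R ^+ 2) = 1.
Proof.
have k0 : 0 < 1 + k%:R ^+ 2 :> R by rewrite ltr_pwDl ?sqr_ge0.
by rewrite exprVn sqr_sqrtr ?(ltW k0)// mulVf// gt_eqF.
Qed.

Lemma direction_unit k b : dot (direction k b) (direction k b) = 1.
Proof.
rewrite dotZl dotZr mulrA -expr2 -[RHS](scale2 k); congr (_ * _).
by case: b; rewrite !(dotDl, dotDr, dotZl, dotZr) (dotC e2 e1) e11 e22 e12; ring.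
Qed.

(** The Hilbert-Schmidt norm of [S] on the plane is the same in every rotated frame: the cross terms
    cancel. *)
Lemma direction_frame k (S : 'M[R]_n) :
  dot (direction k false *m S) (direction k false *m S) +
  dot (direction k true *m S) (direction k true *m S) =
  dot (e1 *m S) (e1 *m S) + dot (e2 *m S) (e2 *m S).
Proof.
rewrite -[RHS]mul1r -{1}(scale2 k) -!scalemxAl !mulmxDl -!scalemxAl.
rewrite !(dotDl, dotDr, dotZl, dotZr) (dotC (e2 *m S) (e1 *m S)); ring.
Qed.

(** Squared cosines between distinct frames of index at most [M] stay below [1 - t] with
    [t = (1 + M ^ 2) ^ -2]; the factor 2 comes from [sqrt (1 - t) <= 1 - t / 2]. *)
Definition separation (M : nat) : R := (2 * (1 + M%:R ^+ 2) ^+ 2)^-1.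

Lemma separation_gt0 M : 0 < separation M.
Proof. by rewrite invr_gt0 mulr_gt0// exprn_gt0// ltr_pwDl ?sqr_ge0. Qed.

Lemma separation_le1 M : separation M <= 1.
Proof.
rewrite invf_le1; last by rewrite -invr_gt0 separation_gt0.
have : 0 <= M%:R ^+ 2 :> R by rewrite sqr_ge0.
by move: (M%:R ^+ 2) => t t0; rewrite expr2; nra.
Qed.

(* [(1 + kl)^2 + (k - l)^2 = (1 + k^2) (1 + l^2)] with both squares at least 1. *)
Lemma direction_separated M k l b b' : (k <= M)%N -> (l <= M)%N -> k != l ->
  `|dot (direction k b) (direction l b')| <= 1 - separation M.
Proof.
move=> kM lM kl.
have s1 := separation_le1 M; have s0 := separation_gt0 M.
rewrite -(ler_pXn2r (ltn0Sn 1)) ?nnegrE ?subr_ge0// real_normK ?num_real//.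
rewrite dotZl dotZr mulrA exprMn exprMn.
have hk := scale2 k; have hl := scale2 l.
have inv_ge (j : nat) : (j <= M)%N ->
    (1 + M%:R ^+ 2)^-1 <= (Num.sqrt (1 + j%:R ^+ 2 : R))^-1 ^+ 2.
  have j0 (i : nat) : 0 < 1 + i%:R ^+ 2 :> R by rewrite ltr_pwDl ?sqr_ge0.
  move=> jM; rewrite exprVn sqr_sqrtr ?(ltW (j0 _))// lef_pV2 ?posrE ?j0//.
  by rewrite lerD2l ler_pXn2r ?nnegrE ?ler0n ?ler_nat.
have ik := inv_ge _ kM; have il := inv_ge _ lM.
move: hk hl ik il.
set r := _ ^-1 ^+ 2; set r' := _^-1 ^+ 2; set i := (1 + _)^-1 => hk hl ik il.
have i0 : 0 <= i by rewrite invr_ge0 addr_ge0 ?sqr_ge0.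
have sE : 2 * separation M = i ^+ 2.
  by rewrite /separation invfM mulrA mulfV ?pnatr_eq0// mul1r exprVn.
have kl1 : 1 <= (k%:R - l%:R) ^+ 2 :> R.
  have : (k < l)%N || (l < k)%N by rewrite -neq_ltn.
  by case/orP; rewrite -(ler_nat R) -natr1; nra.
have kl0 : 0 <= k%:R * l%:R :> R by rewrite mulr_ge0.
have rr : i ^+ 2 <= r * r' by rewrite expr2 ler_pM.
set m := dot _ _.
have hm : m ^+ 2 <= (1 + k%:R ^+ 2) * (1 + l%:R ^+ 2) - 1.
  rewrite {}/m; case: b; case: b'; rewrite !(dotDl, dotDr, dotZl, dotZr);
  by rewrite (dotC e2 e1) e11 e22 e12; nra.
have : r * r' * m ^+ 2 <= 1 - r * r'.
  have -> : 1 - r * r' = r * r' * ((1 + k%:R ^+ 2) * (1 + l%:R ^+ 2) - 1).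
    have := congr2 *%R hk hl; move: (k%:R ^+ 2) (l%:R ^+ 2) => K L; lra.
  by rewrite ler_wpM2l// (le_trans _ rr)// sqr_ge0.
by move: (r * r' * _) => Z; nra.
Qed.

End Directions.

(** * The slab norms and the lower bound on their distortion *)

Section SlabNorm.
Variables (R : realType) (n : nat) (e1 e2 : 'rV[R]_n).
Hypotheses (e11 : dot e1 e1 = 1) (e22 : dot e2 e2 = 1) (e12 : dot e1 e2 = 0).
Variables (c : R) (c1 : 1 <= c).

Local Notation u := (direction e1 e2).

(* Its unit ball is the Euclidean ball cut by the slabs [|<u k b, x>| <= 1/c]
   for [1 <= k <= N]; the frame [k = 0] is left out. *)
Definition slab_fun (N : nat) (x : 'rV[R]_n) : R :=
  \big[Order.max/enorm x]_(i : 'I_N * bool) (c * `|dot (u i.1.+1 i.2) x|).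

Lemma slab_fun_leP N x B :
  reflect (enorm x <= B /\
           forall (k : 'I_N) b, c * `|dot (u k.+1 b) x| <= B)
          (slab_fun N x <= B).
Proof.
apply: (iffP (bigmax_leP _ _ _ _)) => -[h1 h2]; split=> // k b; exact: (h2 (k, b)).
Qed.

Lemma enorm_le_slab N x : enorm x <= slab_fun N x.
Proof. by have /slab_fun_leP[] := lexx (slab_fun N x). Qed.

Lemma slab_fun_ge N (k : 'I_N) b x : c * `|dot (u k.+1 b) x| <= slab_fun N x.
Proof. by have /slab_fun_leP[_] := lexx (slab_fun N x). Qed.

Let c0 : 0 < c. Proof. exact: lt_le_trans c1. Qed.

Lemma slab_le_enorm N x : slab_fun N x <= c * enorm x.
Proof.
apply/slab_fun_leP; split=> [|k b]; first by rewrite ler_peMl ?enorm_ge0.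
rewrite ler_pM2l// (le_trans (dot_le_enorm _ _))// {1}/enorm.
by rewrite direction_unit// sqrtr1 mul1r.
Qed.

Lemma slab_funD N x y : slab_fun N (x + y) <= slab_fun N x + slab_fun N y.
Proof.
apply/slab_fun_leP; split=> [|k b].
  by rewrite (le_trans (enormD _ _))// lerD ?enorm_le_slab.
have := slab_fun_ge k b x; have := slab_fun_ge k b y; rewrite dotDr.
have := ler_normD (dot (u k.+1 b) x) (dot (u k.+1 b) y).
rewrite -(ler_pM2l c0) mulrDr; lra.
Qed.

Lemma slab_funZ N a x : slab_fun N (a *: x) = `|a| * slab_fun N x.
Proof.
have le b y : slab_fun N (b *: y) <= `|b| * slab_fun N y.
  apply/slab_fun_leP; split=> [|k d].
    by rewrite enormZ ler_wpM2l// enorm_le_slab.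
  by rewrite dotZr normrM mulrCA ler_wpM2l// slab_fun_ge.
apply/eqP; rewrite eq_le le/=; have [->|an0] := eqVneq a 0.
  by rewrite normr0 mul0r (le_trans _ (enorm_le_slab _ _))// enorm_ge0.
have := le a^-1 (a *: x); rewrite scalerA mulVf// scale1r normfV.
by rewrite ler_pdivlMl ?normr_gt0.
Qed.

Lemma slab_fun_eq0 N x : slab_fun N x = 0 -> x = 0.
Proof.
move=> x0; apply: enorm_eq0; apply/eqP; rewrite eq_le enorm_ge0 andbT.
by rewrite -x0 enorm_le_slab.
Qed.

Definition slab_norm N : norm R n :=
  Norm (@slab_funD N) (@slab_funZ N) (@slab_fun_eq0 N).

Lemma slab_norm_mono N N' x : (N <= N')%N -> slab_norm N x <= slab_norm N' x.
Proof.
move=> NN'; apply/slab_fun_leP; split=> [|k b]; first exact: enorm_le_slab.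
exact: (slab_fun_ge (widen_ord NN' k)).
Qed.

Lemma slab_norm_le N N' x : slab_norm N x <= c * slab_norm N' x.
Proof. by rewrite (le_trans (slab_le_enorm _ _))// ler_pM2l// enorm_le_slab. Qed.

Variable M : nat.
Hypothesis cM : 8 * (c ^+ 2 - 1) <= separation R M.

(** The frame [k = 0] avoids every cap: [cM] and [c ^+ 2 - 1 >= 2 * (c - 1)] give
    [c * (1 - separation R M) <= 1]. *)
Lemma slab_norm_e N b : (N <= M)%N -> slab_norm N (u 0 b) <= 1.
Proof.
move=> NM; apply/slab_fun_leP; split=> [|k b'].
  by rewrite /enorm direction_unit// sqrtr1.
have := @direction_separated _ _ _ _ e11 e22 e12 M k.+1 0 b' b
  (leq_trans (ltn_ord k) NM) isT isT.
rewrite -(ler_pM2l c0) => h; apply: le_trans h _.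
have := separation_gt0 R M; move: (separation R M) cM => s h s0.
have := sqr_ge0 (c - 1); have : s <= c * s by apply: ler_peMl => //; exact: ltW.
lra.
Qed.

Lemma slab_distortion_ge N N' (S T : 'M[R]_n) alpha beta :
    (N' <= M)%N -> (N * 2 < N')%N -> S *m T = 1%:M -> 0 <= alpha -> 0 <= beta ->
    (forall x, slab_norm N' (x *m T) <= alpha * slab_norm N x) ->
    (forall x, slab_norm N (x *m S) <= beta * slab_norm N' x) ->
  c <= alpha * beta.
Proof.
move=> NM NN ST al0 be0 hT hS; rewrite leNgt; apply/negP => ab.
have hT' x : slab_norm N' x <= alpha * slab_norm N (x *m S).
  by rewrite -{1}(mulmx1 x) -ST mulmxA.
have lo x : enorm x <= alpha * c * enorm (x *m S).
  rewrite (le_trans (enorm_le_slab N' _))// (le_trans (hT' _))// -mulrA.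
  by rewrite ler_wpM2l// slab_le_enorm.
have up x : enorm (x *m S) <= beta * c * enorm x.
  rewrite (le_trans (enorm_le_slab N _))// (le_trans (hS _))// -mulrA.
  by rewrite ler_wpM2l// slab_le_enorm.
(* Either both images of some frame of the larger family avoid the caps of the smaller one, or every
   frame has a direction whose image meets a cap. *)
have [[k kgood]|bad] := pselect (exists k : 'I_N', forall b,
    slab_norm N (u k.+1 b *m S) <= enorm (u k.+1 b *m S)).
  have ge b : c ^+ 2 <= alpha ^+ 2 * dot (u k.+1 b *m S) (u k.+1 b *m S).
    rewrite -sqr_enorm -exprMn ler_pXn2r ?nnegrE ?mulr_ge0 ?enorm_ge0 ?(ltW c0)//.
    apply: le_trans (_ : alpha * slab_norm N (u k.+1 b *m S) <= _); last first.
      by rewrite ler_wpM2l.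
    apply: le_trans (hT' _); apply: le_trans (slab_fun_ge k b _).
    by rewrite direction_unit// normr1 mulr1.
  have le b : dot (u 0 b *m S) (u 0 b *m S) <= beta ^+ 2.
    rewrite -sqr_enorm ler_pXn2r ?nnegrE ?enorm_ge0//.
    rewrite (le_trans (enorm_le_slab N _))// (le_trans (hS _))//.
    by rewrite ler_piMr// slab_norm_e.
  (* Frames [k.+1] and [0] have the same Hilbert-Schmidt sum, so [ge] and [le] combine to
     [2 * c ^+ 2 <= 2 * (alpha * beta) ^+ 2]. *)
  have := direction_frame e1 e2 k.+1 S.
  rewrite -(direction_frame e1 e2 0 S) => fr.
  have : (alpha * beta) ^+ 2 < c ^+ 2.
    by rewrite ltr_pXn2r ?nnegrE ?mulr_ge0 ?(ltW c0).
  have : alpha ^+ 2 * (dot (u 0 false *m S) (u 0 false *m S) +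
      dot (u 0 true *m S) (u 0 true *m S)) <= alpha ^+ 2 * (beta ^+ 2 + beta ^+ 2).
    by rewrite ler_wpM2l ?sqr_ge0// lerD.
  have := ge false; have := ge true; rewrite -fr exprMn; lra.
(* Pigeonhole: [f] sends each of the [N'] frames to one of [N * 2] caps, and [caps_disjoint] makes
   it injective. *)
have /choice[f fP] : forall k : 'I_N', exists i : 'I_N * bool, exists b,
    enorm (u k.+1 b *m S) < c * `|dot (u i.1.+1 i.2) (u k.+1 b *m S)|.
  move=> k; apply: contrapT => h; apply: bad; exists k => b.
  apply/slab_fun_leP; split=> // i d; rewrite leNgt; apply/negP => lt.
  by apply: h; exists (i, d), b.
have /leq_card : injective f; last first.
  by rewrite card_prod !card_ord card_bool leqNgt NN.
move=> k l fkl; apply/eqP; apply: contraT => kl.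
have [b hb] := fP k; have [b' hb'] := fP l; rewrite -fkl in hb'.
have d01 : 0 < separation R M <= 1 by rewrite separation_gt0 separation_le1.
have kM := leq_trans (ltn_ord k) NM; have lM := leq_trans (ltn_ord l) NM.
have sep := direction_separated e11 e22 e12 b b' kM lM kl.
have du i d := direction_unit e11 e22 e12 i d.
case: (caps_disjoint lo up al0 be0 ab c1 d01 cM (du _ _) (du _ _) (du _ _) sep
  hb hb').
Qed.

End SlabNorm.

(** * Operator norms as suprema *)

Section OperatorNorm.
Variables (R : realType) (n : nat).
Implicit Types (p q : norm R n) (T : 'M[R]_n).

Lemma norm0 p : p 0 = 0.
Proof. by have := normZ p 0 0; rewrite scale0r normr0 mul0r. Qed.

Lemma norm_ge0 p x : 0 <= p x.
Proof.
have := normD p x (- x); rewrite subrr norm0 -scaleN1r normZ normrN1 mul1r.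
lra.
Qed.

Lemma opnorm_le p q T C : 0 <= C -> (forall x, q (x *m T) <= C * p x) ->
  opnorm p q T <= C.
Proof.
move=> C0 h; apply: ge_sup.
  by exists (q (0 *m T)), 0 => //=; rewrite norm0.
by move=> _ [x /= px <-]; rewrite (le_trans (h x))// ler_piMr.
Qed.

(** Any linear bound, whatever the sign of [C], makes the set of values bounded, so that [sup] is a
    true supremum; rescaling to [p x = 1] gives the inequality. *)
Lemma le_opnorm p q T C : (forall x, q (x *m T) <= C * p x) ->
  0 <= opnorm p q T /\ forall x, q (x *m T) <= opnorm p q T * p x.
Proof.
move=> h.
have ub : has_ubound [set q (x *m T) | x in [set x | p x <= 1]].
  exists `|C| => _ [x /= px <-]; rewrite (le_trans (h x))//.
  rewrite (le_trans (ler_norm _))// normrM ler_piMr// ger0_norm ?norm_ge0//.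
have le_sup y : p y <= 1 -> q (y *m T) <= opnorm p q T.
  by move=> py; apply: (ub_le_sup ub); exists y.
split=> [|x].
  by rewrite -(norm0 q) -(mul0mx _ T) le_sup// norm0.
have [x0|xn0] := eqVneq (p x) 0.
  by rewrite (norm_eq0 x0) mul0mx !norm0 mulr0.
have px : 0 < p x by rewrite lt0r xn0 norm_ge0.
rewrite -ler_pdivrMr// mulrC -[X in X * _]ger0_norm ?invr_ge0 ?(ltW px)//.
rewrite -normZ scalemxAl.
apply: le_sup.
by rewrite normZ ger0_norm ?invr_ge0 ?(ltW px)// mulVf.
Qed.

Lemma norm_dBM_sym p q : norm_dBM p q = norm_dBM q p.
Proof.
congr inf; apply/seteqP; split=> _ [T /= uT <-]; exists (invmx T);
  by rewrite /= ?unitmx_inv// invmxK mulrC.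
Qed.

End OperatorNorm.

(** * Banach-Mazur distances between slab norms *)

Section SlabDistance.
Variables (R : realType) (n : nat) (e1 e2 : 'rV[R]_n).
Hypotheses (e11 : dot e1 e1 = 1) (e22 : dot e2 e2 = 1) (e12 : dot e1 e2 = 0).
Variables (c : R) (c1 : 1 <= c) (M : nat).
Hypothesis cM : 8 * (c ^+ 2 - 1) <= separation R M.

Local Notation slab := (slab_norm e1 e2 c1).

Lemma slab_norm_bounded N N' (T : 'M[R]_n) :
  exists C, forall x, slab N' (x *m T) <= C * slab N x.
Proof.
have [C C0 hC] := enorm_mulmx_bounded T; exists (c * C) => x.
rewrite (le_trans (slab_le_enorm e11 e22 e12 c1 N' _))// -mulrA.
rewrite ler_wpM2l ?(le_trans ler01)// (le_trans (hC x))// ler_wpM2l//.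
exact: enorm_le_slab.
Qed.

Lemma slab_norm_dBM_lbound N N' :
  has_lbound [set opnorm (slab N) (slab N') T * opnorm (slab N') (slab N) (invmx T)
             | T in [set T : 'M[R]_n | T \in unitmx]].
Proof.
exists 0 => _ [T _ <-]; apply: mulr_ge0.
  by have [C /le_opnorm[]] := slab_norm_bounded N N' T.
by have [C /le_opnorm[]] := slab_norm_bounded N' N (invmx T).
Qed.

Lemma slab_norm_dBM_le N N' C C' : 0 <= C -> 0 <= C' ->
  (forall x, slab N' x <= C * slab N x) -> (forall x, slab N x <= C' * slab N' x) ->
  norm_dBM (slab N) (slab N') <= C * C'.
Proof.
move=> C0 C0' h h'.
(* The identity operator serves as competitor in the infimum. *)
apply: le_trans (_ : opnorm (slab N) (slab N') 1%:M *
   opnorm (slab N') (slab N) (invmx 1%:M) <= _).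
  by apply: (ge_inf (slab_norm_dBM_lbound N N')); exists 1%:M; rewrite //= unitmx1.
apply: ler_pM.
- by have [D /le_opnorm[]] := slab_norm_bounded N N' 1%:M.
- by have [D /le_opnorm[]] := slab_norm_bounded N' N (invmx 1%:M).
- by apply: opnorm_le => // x; rewrite mulmx1.
- by apply: opnorm_le => // x; rewrite invmx1 mulmx1.
Qed.

Lemma slab_norm_dBM N N' : (N' <= M)%N -> (N * 2 < N')%N ->
  norm_dBM (slab N) (slab N') = c.
Proof.
move=> NM NN; apply/eqP; rewrite eq_le; apply/andP; split.
  rewrite -[leRHS]mulr1; apply: slab_norm_dBM_le => //.
  - exact: le_trans c1.
  - by move=> x; apply: slab_norm_le.
  - move=> x; rewrite mul1r; apply: slab_norm_mono.
    by rewrite ltnW// (leq_ltn_trans _ NN)// leq_pmulr.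
(* The lower bound passes to the infimum because the set is nonempty; [slab_distortion_ge] then
   treats each [T]. *)
apply: lb_le_inf.
  by eexists; exists 1%:M => /=; [exact: unitmx1|reflexivity].
move=> _ [T /= uT <-].
have [C /le_opnorm[a0 ha]] := slab_norm_bounded N N' T.
have [C' /le_opnorm[b0 hb]] := slab_norm_bounded N' N (invmx T).
exact: (slab_distortion_ge e11 e22 e12 cM NM NN (mulVmx uT) a0 b0 ha hb).
Qed.

Lemma slab_norm_dBM_refl N : norm_dBM (slab N) (slab N) <= 1.
Proof.
by rewrite -[leRHS]mulr1; apply: slab_norm_dBM_le => // x; rewrite mul1r.
Qed.

End SlabDistance.

(** * Construction of the equilateral set *)

Lemma pow3_le (i m : nat) : (i < m -> 3 ^ i * 2 < 3 ^ m)%N.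
Proof.
move=> im; apply: leq_trans (_ : 3 ^ i.+1 <= _)%N; last by rewrite leq_pexp2l.
by rewrite expnSr ltn_pmul2l// expn_gt0.
Qed.

Theorem corollary1p9 (R : realType) (n m : nat) (hn : (2 <= n)%N)
    (hm : (2 <= m)%N) :
  exists2 S : set (BMs R n), (S #= `I_m)%card & equilateral S.
Proof.
pose e (k : 'I_n) : 'rV[R]_n := delta_mx 0 k.
have dot_e k l : dot (e k) (e l) = (k == l)%:R.
  rewrite /dot (bigD1 k)//= big1 => [|i ik].
    by rewrite !mxE !eqxx mul1r addr0.
  by rewrite !mxE (negbTE ik) andbF mul0r.
pose k0 := Ordinal (ltnW hn); pose k1 := Ordinal hn.
have e11 : dot (e k0) (e k0) = 1%R by rewrite dot_e eqxx.
have e22 : dot (e k1) (e k1) = 1%R by rewrite dot_e eqxx.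
have e12 : dot (e k0) (e k1) = 0%R by rewrite dot_e.
pose M := (3 ^ m)%N.
have s0 := separation_gt0 R M; have s1 := separation_le1 R M.
(* With [t = separation R M / 24 <= 1], [8 * (c ^+ 2 - 1) = 16 * t + 8 * t ^+ 2 <= 24 * t]. *)
pose c : R := (1 + separation R M / 24)%R.
have c_gt1 : (1 < c)%R by rewrite /c; lra.
have c1 := ltW c_gt1.
have cM : (8 * (c ^+ 2 - 1) <= separation R M)%R by rewrite /c; nra.
(* Powers of 3 more than double at each step, so any two of these norms satisfy the counting
   condition [N * 2 < N']. *)
pose p i := slab_norm (e k0) (e k1) c1 (3 ^ i).
have dp i j : (i < m)%N -> (j < m)%N -> i != j -> norm_dBM (p i) (p j) = c.
  wlog ij : i j / (i < j)%N.
    move=> H im jm; rewrite neq_ltn => /orP[ij|ji].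
      by apply: H => //; rewrite neq_ltn ij.
    by rewrite norm_dBM_sym; apply: H => //; rewrite neq_ltn ji.
  move=> im jm _; apply: (slab_norm_dBM e11 e22 e12 c1 cM) => //; last exact: pow3_le.
  by rewrite leq_pexp2l// ltnW.
pose X i : BMs R n := (\pi_(BMs R n) (p i))%qT.
(* Isometric norms would be at distance at most 1, whereas distinct indices give [c > 1]. *)
have inj : {in `I_m &, injective X}.
  move=> i j /set_mem /= im /set_mem /= jm /BMs_eqP pij.
  apply/eqP; apply: contraT => ij; have := c_gt1.
  rewrite -(dp _ _ im jm ij) (norm_dBM_isometric pij (isometric_refl _)) ltNge.
  by rewrite (slab_norm_dBM_refl e11 e22 e12).
exists (X @` `I_m).
  exact: inj_card_eq.
exists c; first exact: lt_trans c_gt1.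
move=> _ _ [i /= im <-] [j /= jm <-] ij; rewrite pi_dBM; apply: dp => //.
by apply: contra_notN ij => /eqP ->.
Qed.
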